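(* Let $n,m\ge1$ be integers and let $x_1,\ldots,x_n,z_1,\ldots,z_m$ be indeterminates. Then, as formal power series, $$\sum_{\pi\in\mathrm{PP}(\infty,n,m)}\ \prod_{(i,j)\in\mathrm{Des}(\pi)} x_i z_{\pi_{ij}}=\prod_{i=1}^{n}\prod_{\ell=1}^{m}\frac{1}{1-x_i z_\ell}.$$
   Context: A plane partition $\pi=(\pi_{ij})_{i,j\ge1}$ is a two-dimensional array of nonnegative integers with finitely many nonzero entries such that $\pi_{ij}\ge\pi_{i+1\,j}$ and $\pi_{ij}\ge\pi_{i\,j+1}$ for all $i,j\ge1$ ($i$ is the row index, $j$ the column index). $\mathrm{PP}(\infty,n,m)$ is the set of plane partitions with at most $n$ nonzero rows and all entries at most $m$ (the number of columns is not restricted). The descent set of $\pi$ is $\mathrm{Des}(\pi)=\{(i,j):\pi_{ij}>\pi_{i+1\,j}\}$. *)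

(* Defs.v *)
From HB Require Import structures.
From mathcomp Require Import all_boot all_order all_algebra.
From mathcomp Require Import boolp classical_sets functions cardinality.
From mathcomp Require Import fsbigop.
From mathcomp Require Import mpoly.

Set Implicit Arguments.
Unset Strict Implicit.
Unset Printing Implicit Defensive.

Import GRing.Theory.

Local Open Scope classical_set_scope.
Local Open Scope ring_scope.

Reserved Notation "{ 'mfps' R [ k ] }"
  (at level 0, R at level 2, k at level 2, format "{ 'mfps'  R [ k ] }").

(* A record rather than a bare function type, which already carries the
   pointwise product as its ring structure. *)
Record mfps (k : nat) (R : Type) : Type :=
  MFps { mfps_coef :> 'X_{1..k} -> R }.

Notation "{ 'mfps' R [ k ] }" := (mfps k R) : type_scope.

Lemma mfpsP (k : nat) (R : Type) (f g : {mfps R[k]}) :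
  (forall m, f m = g m) -> f = g.
Proof. by case: f g => [f] [g] /= fg; congr MFps; apply/funext. Qed.

HB.instance Definition _ (k : nat) (R : Type) := gen_eqMixin {mfps R[k]}.
HB.instance Definition _ (k : nat) (R : Type) := gen_choiceMixin {mfps R[k]}.

Section MfpsZmodule.
Variables (k : nat) (R : zmodType).
Implicit Types f g h : {mfps R[k]}.

Definition mfps_zero : {mfps R[k]} := MFps (fun=> 0).
Definition mfps_opp f : {mfps R[k]} := MFps (fun m => - f m).
Definition mfps_add f g : {mfps R[k]} := MFps (fun m => f m + g m).

Fact mfps_addA : associative mfps_add.
Proof. by move=> f g h; apply: mfpsP => m /=; rewrite addrA. Qed.
Fact mfps_addC : commutative mfps_add.
Proof. by move=> f g; apply: mfpsP => m /=; rewrite addrC. Qed.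
Fact mfps_add0 : left_id mfps_zero mfps_add.
Proof. by move=> f; apply: mfpsP => m /=; rewrite add0r. Qed.
Fact mfps_addN : left_inverse mfps_zero mfps_opp mfps_add.
Proof. by move=> f; apply: mfpsP => m /=; rewrite addNr. Qed.

HB.instance Definition _ := GRing.isZmodule.Build {mfps R[k]}
  mfps_addA mfps_addC mfps_add0 mfps_addN.

Lemma mfpsD f g m : (f + g) m = f m + g m. Proof. by []. Qed.
Lemma mfpsN f m : (- f) m = - f m. Proof. by []. Qed.
Lemma mfps0 m : (0 : {mfps R[k]}) m = 0. Proof. by []. Qed.

End MfpsZmodule.

Section MfpsRing.
Variables (k : nat) (R : comNzRingType).
Implicit Types (f g h : {mfps R[k]}) (p q : {mpoly R[k]}).

Definition mfpsC (c : R) : {mfps R[k]} :=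
  MFps (fun m => if m == 0%MM then c else 0).

Definition mfpsX (i : 'I_k) : {mfps R[k]} :=
  MFps (fun m => (m == U_(i)%MM)%:R).

(* The same formula as [mcoeffM] for polynomials; the degree bound on the pair
   only makes the index type finite. *)
Definition mfps_mul f g : {mfps R[k]} := MFps (fun m =>
  \sum_(c : 'X_{1..k < (mdeg m).+1, (mdeg m).+1} | m == (c.1 + c.2)%MM)
     f c.1 * g c.2).

Definition mfps_trunc (d : nat) f : {mpoly R[k]} :=
  \sum_(m : 'X_{1..k < d.+1}) f m *: 'X_[m].

Definition mfps_agree (d : nat) p f : Prop :=
  forall m, (mdeg m <= d)%N -> p@_m = f m.

Lemma mfps_truncP d f : mfps_agree d (mfps_trunc d f) f.
Proof.
move=> m md; rewrite /mfps_trunc raddf_sum /=.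
have md' : (mdeg m < d.+1)%N by [].
rewrite (bigD1 (BMultinom md')) //= mcoeffZ mcoeffX eqxx mulr1.
rewrite big1 ?addr0 // => c cm; rewrite mcoeffZ mcoeffX.
case: eqP => [e|_]; last by rewrite mulr0.
by move: cm; rewrite -val_eqE /= e eqxx.
Qed.

Lemma mfps_agreeM d p q f g :
  mfps_agree d p f -> mfps_agree d q g -> mfps_agree d (p * q) (mfps_mul f g).
Proof.
move=> pf qg m md; rewrite mcoeffM /=; apply: eq_bigr => c _.
have lec (b : 'X_{1..k < (mdeg m).+1}) : (mdeg b <= d)%N.
  by rewrite (leq_trans _ md) // -ltnS bmdeg.
by rewrite pf ?qg.
Qed.

Lemma mfps_agree_inj d p f g m : (mdeg m <= d)%N ->
  mfps_agree d p f -> mfps_agree d p g -> f m = g m.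
Proof. by move=> md pf pg; rewrite -pf // pg. Qed.

Lemma mfps_agreeD d p q f g :
  mfps_agree d p f -> mfps_agree d q g -> mfps_agree d (p + q) (f + g).
Proof. by move=> pf qg m md; rewrite mcoeffD pf ?qg. Qed.

Lemma mfps_agree1 d : mfps_agree d 1 (mfpsC 1).
Proof. by move=> m _; rewrite mcoeff1 /=; case: eqP. Qed.

Fact mfps_mulA : associative mfps_mul.
Proof.
move=> f g h; apply: mfpsP => m; have T := @mfps_truncP (mdeg m).
apply: (mfps_agree_inj (leqnn _)).
  exact: (mfps_agreeM (T f) (mfps_agreeM (T g) (T h))).
by rewrite mulrA; exact: (mfps_agreeM (mfps_agreeM (T f) (T g)) (T h)).
Qed.

Fact mfps_mulC : commutative mfps_mul.
Proof.
move=> f g; apply: mfpsP => m; have T := @mfps_truncP (mdeg m).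
apply: (mfps_agree_inj (leqnn _)); first exact: (mfps_agreeM (T f) (T g)).
by rewrite mulrC; exact: (mfps_agreeM (T g) (T f)).
Qed.

Fact mfps_mul1 : left_id (mfpsC 1) mfps_mul.
Proof.
move=> f; apply: mfpsP => m; have T := @mfps_truncP (mdeg m).
apply: (mfps_agree_inj (leqnn _)).
  exact: (mfps_agreeM (@mfps_agree1 _) (T f)).
by rewrite mul1r; exact: T.
Qed.

Fact mfps_mulDl : left_distributive mfps_mul +%R.
Proof.
move=> f g h; apply: mfpsP => m; have T := @mfps_truncP (mdeg m).
apply: (mfps_agree_inj (leqnn _)).
  exact: (mfps_agreeM (mfps_agreeD (T f) (T g)) (T h)).
rewrite mulrDl.
exact: (mfps_agreeD (mfps_agreeM (T f) (T h)) (mfps_agreeM (T g) (T h))).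
Qed.

Fact mfps_1neq0 : mfpsC 1 != 0.
Proof.
apply/eqP => /(congr1 (fun f : {mfps R[k]} => f 0%MM)) /=.
by rewrite eqxx => /eqP; rewrite oner_eq0.
Qed.

HB.instance Definition _ := GRing.Zmodule_isComNzRing.Build {mfps R[k]}
  mfps_mulA mfps_mulC mfps_mul1 mfps_mulDl mfps_1neq0.

Lemma mfpsM f g m : (f * g) m =
  \sum_(c : 'X_{1..k < (mdeg m).+1, (mdeg m).+1} | m == (c.1 + c.2)%MM)
     f c.1 * g c.2.
Proof. by []. Qed.

Lemma mfps1 m : (1 : {mfps R[k]}) m = (m == 0%MM)%:R.
Proof. by rewrite /=; case: eqP. Qed.

Lemma mfpsM_coef0 f g : (f * g) 0%MM = f 0%MM * g 0%MM.
Proof.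
have T := @mfps_truncP 0.
rewrite -(mfps_agreeM (T f) (T g)) ?mdeg0 // mcoeff0_is_multiplicative.
by rewrite !T ?mdeg0.
Qed.

Lemma mfps_eqM d f f' g g' :
  (forall m, (mdeg m <= d)%N -> f m = f' m) ->
  (forall m, (mdeg m <= d)%N -> g m = g' m) ->
  forall m, (mdeg m <= d)%N -> (f * g) m = (f' * g') m.
Proof.
move=> ff gg m md; rewrite !mfpsM; apply: eq_bigr => c _.
have lec (b : 'X_{1..k < (mdeg m).+1}) : (mdeg b <= d)%N.
  by rewrite (leq_trans _ md) // -ltnS bmdeg.
by rewrite ff ?gg.
Qed.

Lemma mfps_exp_low f : f 0%MM = 0 ->
  forall e m, (mdeg m < e)%N -> (f ^+ e) m = 0.
Proof.
move=> f0; elim=> [|e IHe] m // me; rewrite exprS mfpsM big1 // => c /eqP mE.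
have [->|c10] := eqVneq (bmnm c.1) 0%MM; first by rewrite f0 mul0r.
rewrite IHe ?mulr0 //.
rewrite mE mdegD ltnS in me; apply: leq_trans me.
by rewrite -[X in (X < _)%N]add0n ltn_add2r lt0n mdeg_eq0.
Qed.

End MfpsRing.

Section MfpsUnitRing.
Variables (k : nat) (R : comUnitRingType).
Implicit Types f g h : {mfps R[k]}.

Definition mfps_unit : {pred {mfps R[k]}} :=
  fun f => f 0%MM \is a GRing.unit.

(* With [u] the inverse of the constant coefficient, [1 / f] is the geometric
   series [u * (1 + r + r^2 + ...)] for [r = 1 - u * f], which has no constant
   term; powers beyond the degree of [m] do not contribute to the coefficient
   of [m]. *)
Definition mfps_geom f : {mfps R[k]} := MFps (fun m =>
  (mfpsC k (f 0%MM)^-1 *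
     \sum_(e < (mdeg m).+1) (1 - mfpsC k (f 0%MM)^-1 * f) ^+ e) m).

Definition mfps_inv f : {mfps R[k]} := if mfps_unit f then mfps_geom f else f.

Fact mfps_mulV : {in mfps_unit, left_inverse 1 mfps_inv *%R}.
Proof.
move=> f fU; rewrite /mfps_inv; have fU' : mfps_unit f by exact: fU.
rewrite fU'; apply: mfpsP => m.
set u := mfpsC k (f 0%MM)^-1; pose r := 1 - u * f.
have r0 : r 0%MM = 0.
  rewrite /r mfpsD mfpsN mfps1 mfpsM_coef0 /= eqxx mulVr ?subrr //.
pose S d := \sum_(e < d.+1) r ^+ e.
have coef_sum (I : finType) (F : I -> {mfps R[k]}) c :
    (\sum_i F i) c = \sum_i F i c.
  by apply: (big_morph (fun f : {mfps R[k]} => f c)) => [g h|].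
have geomE c : (mdeg c <= mdeg m)%N -> mfps_geom f c = (u * S (mdeg m)) c.
  move=> cm; change (mfps_geom f c) with ((u * S (mdeg c)) c).
  apply: (mfps_eqM (d := mdeg c)) => // b bc.
  rewrite /S !coef_sum.
  rewrite (big_ord_widen (mdeg m).+1 (fun e => (r ^+ e) b)) //.
  rewrite big_mkcond /=; apply: eq_bigr => e _.
  by case: ltnP => // ce; rewrite mfps_exp_low // (leq_ltn_trans bc ce).
rewrite (mfps_eqM (d := mdeg m) (f' := u * S (mdeg m)) (g' := f)) //.
rewrite mulrAC.
have -> : u * f = 1 - r by rewrite /r opprB addrCA subrr addr0.
rewrite -[1 - r]opprB mulNr /S -subrX1 opprB mfpsD mfpsN mfps_exp_low //.
by rewrite subr0.
Qed.

Fact mfps_unitPl f g : g * f = 1 -> mfps_unit f.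
Proof.
move=> /(congr1 (fun f : {mfps R[k]} => f 0%MM)).
rewrite mfpsM_coef0 mfps1 eqxx => gf1.
by apply/unitrPr; exists (g 0%MM); rewrite mulrC.
Qed.

Fact mfps_inv_out : {in [predC mfps_unit], mfps_inv =1 id}.
Proof. by move=> f; rewrite inE /mfps_inv; case: ifP => // fU /negP[]. Qed.

HB.instance Definition _ := GRing.ComNzRing_hasMulInverse.Build {mfps R[k]}
  mfps_mulV mfps_unitPl mfps_inv_out.

Lemma mfps_unitE f : (f \is a GRing.unit) = (f 0%MM \is a GRing.unit).
Proof. by []. Qed.

End MfpsUnitRing.

Section MfpsSum.
Variables (k : nat) (R : nmodType) (I : choiceType).
Implicit Types (A : set I) (F : I -> {mfps R[k]}).

Definition mfps_summable A F : Prop :=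
  forall m, finite_set (A `&` [set i | F i m != 0]).

(* Only meaningful for summable families: [\sum_(i \in A)] is 0 as soon as
   infinitely many terms are nonzero. *)
Definition mfps_sum A F : {mfps R[k]} := MFps (fun m => \sum_(i \in A) F i m).

End MfpsSum.

(* Rows and columns are numbered from 0: [pi i j] is the entry in row [i + 1]
   and column [j + 1]. *)
Definition plane_partition (pi : nat -> nat -> nat) : Prop :=
  [/\ finite_set [set p : nat * nat | pi p.1 p.2 != 0%N],
      forall i j, (pi i.+1 j <= pi i j)%N
    & forall i j, (pi i j.+1 <= pi i j)%N].

Definition PP (n m : nat) : set (nat -> nat -> nat) :=
  [set pi | [/\ plane_partition pi,
                ([set i | exists j, pi i j != 0%N] #<= `I_n)%card
              & forall i j, (pi i j <= m)%N]].

Definition Des (pi : nat -> nat -> nat) : set (nat * nat) :=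
  [set p | (pi p.1.+1 p.2 < pi p.1 p.2)%N].

(* The n + m variables are x_1, ..., x_n followed by z_1, ..., z_m; [xvar i] is
   x_i and [zvar l] is z_l, numbered from 1, and 0 when the number is out of
   range. *)
Definition xvar (R : comNzRingType) (n m i : nat) : {mfps R[n + m]} :=
  \sum_(a < n | a.+1 == i) mfpsX R (lshift m a).

Definition zvar (R : comNzRingType) (n m l : nat) : {mfps R[n + m]} :=
  \sum_(b < m | b.+1 == l) mfpsX R (rshift n b).

Definition des_weight (R : comNzRingType) (n m : nat) (pi : nat -> nat -> nat) :
    {mfps R[n + m]} :=
  \big[*%R/1]_(p \in Des pi) (xvar R n m p.1.+1 * zvar R n m (pi p.1 p.2)).

(* Main.v *)
(* Let G(i,b) be the number of entries of row i of pi that are greater than b.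
   Rows being weakly decreasing, the descents of row i with value b + 1 occupy
   the columns from max(G(i+1,b), G(i,b+1)) up to G(i,b), so the number D(i,b)
   of these descents satisfies the last-passage recursion
     G(i,b) = D(i,b) + max(G(i+1,b), G(i,b+1)).
   Hence pi |-> D is a bijection from PP(oo,n,m) onto the n x m arrays of
   nonnegative integers, and the weight of pi is the product of the
   (x_(i+1) z_(b+1))^D(i,b), with rows i and levels b numbered from 0; summing
   over D gives a product of geometric series. *)
Require Import Defs.
From mathcomp Require Import all_boot all_order all_algebra.
From mathcomp Require Import boolp classical_sets functions cardinality.
From mathcomp Require Import fsbigop mpoly.
From mathcomp Require Import zify.

Set Implicit Arguments.
Unset Strict Implicit.
Unset Printing Implicit Defensive.

Import GRing.Theory.
Local Open Scope classical_set_scope.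
Local Open Scope ring_scope.

(** * Row conjugation and the last-passage recursion *)

Section LastPassage.
Local Open Scope nat_scope.
Implicit Types (n m i j b N : nat) (D G : nat -> nat -> nat).

Definition supported n m G := forall i b, (n <= i) || (m <= b) -> G i b = 0.

Definition lp_eqn D G :=
  forall i b, G i b = D i b + maxn (G i.+1 b) (G i b.+1).

(* The fuel n + m - (i + b) is the distance to the antidiagonal i + b = n + m,
   on and beyond which every cell lies outside the box. *)
Fixpoint lp_fuel D k i b : nat :=
  if k is k'.+1 then D i b + maxn (lp_fuel D k' i.+1 b) (lp_fuel D k' i b.+1)
  else 0.

Definition lp n m D i b := lp_fuel D (n + m - (i + b)) i b.

Lemma lp_supported n m D : supported n m D -> supported n m (lp n m D).
Proof.
move=> Dsupp i b; rewrite /lp; move: (n + m - _) => k.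
elim: k i b => //= k IHk i b ib.
by rewrite Dsupp // !IHk //; lia.
Qed.

Lemma lpP n m D : supported n m D -> lp_eqn D (lp n m D).
Proof.
move=> Dsupp i b; have [le|lt] := leqP (n + m) (i + b).
  have Lsupp := lp_supported Dsupp.
  by rewrite Dsupp ?Lsupp ?maxnn //; lia.
rewrite /lp; have -> : n + m - (i + b) = (n + m - (i + b).+1).+1 by lia.
by rewrite /= addSn addnS.
Qed.

(** Induction on the distance to the antidiagonal i + b = n + m: the recursion only calls cells one
    step closer, and outside the box both arrays vanish. *)
Lemma lp_eqn_inj n m D G G' : supported n m G -> supported n m G' ->
  lp_eqn D G -> lp_eqn D G' -> forall i b, G i b = G' i b.
Proof.
move=> Gs G's GD G'D i b.
have [k] := ubnP (n + m - (i + b)); elim: k i b => // k IHk i b ibk.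
have [ib|/norP[]] := boolP ((n <= i) || (m <= b)); first by rewrite Gs ?G's.
by rewrite -!ltnNge => ? ?; rewrite GD G'D !IHk //; lia.
Qed.

Definition conj_count N (f : nat -> nat) j := \sum_(b < N) (j < f b).

(** Since [f] is weakly decreasing, the [b] with [j < f b] form an initial segment, which [f N = 0]
    keeps below [N]; [conj_count] is its length. *)
Lemma conj_countP N (f : nat -> nat) j k :
  (forall b, f b.+1 <= f b) -> f N = 0 ->
  (k < conj_count N f j) = (j < f k).
Proof.
move=> f_noninc fN0; rewrite /conj_count.
elim: N f f_noninc fN0 k => [|N IHN] f f_noninc fN0 k.
  rewrite big_ord0; suff: f k = 0 by lia.
  by elim: k => // k IHk; have := f_noninc k; lia.
rewrite big_ord_recl /=; under eq_bigr do rewrite /bump /= add1n.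
have IH := IHN (f \o S) (fun b => f_noninc b.+1) fN0.
(* If [f 0 <= j], then [f 1 <= j] as well, and [IH 0] makes the count over the tail zero. *)
move: (IH 0) (f_noninc 0); case: k => [|k]; last move: (IH k.+1) (IH k).
all: rewrite /=; set S := bigop _ _ _; lia.
Qed.

(** Row [i] of [G] is the conjugate partition of row [i] of [pi]; in this form either array
    determines the other. *)
Definition levels (pi G : nat -> nat -> nat) :=
  forall i j b, (b < pi i j) = (j < G i b).

Lemma levels_inj pi G G' : levels pi G -> levels pi G' ->
  forall i b, G i b = G' i b.
Proof.
move=> piG piG' i b; have := piG i (G' i b) b; have := piG i (G i b) b.
by rewrite !piG'; lia.
Qed.

Definition box_monotone n m G :=
  [/\ supported n m G, forall i b, G i.+1 b <= G i b
    & forall i b, G i b.+1 <= G i b].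

Lemma box_monotone_le00 n m G i b : box_monotone n m G -> G i b <= G 0 0.
Proof.
case=> _ Gi Gb; apply: (@leq_trans (G i 0)).
  by elim: b => // b; apply: leq_trans.
by elim: i => // i; apply: leq_trans.
Qed.

Lemma box_monotone_levels n m G : box_monotone n m G ->
  levels (fun i j => conj_count m (G i) j) G.
Proof.
case=> Gs _ Gb i j b; apply: conj_countP => //.
by rewrite Gs // leqnn orbT.
Qed.

Lemma lp_box_monotone n m D : supported n m D -> box_monotone n m (lp n m D).
Proof.
move=> Ds; split=> [|i b|i b]; first exact: lp_supported.
  by rewrite [leqRHS](lpP Ds); lia.
by rewrite [leqRHS](lpP Ds); lia.
Qed.

(** Columns are weakly decreasing, so a nonzero entry in a row [i >= n] makes rows 0 to n all
    nonzero: n + 1 rows, against the cardinality bound. *)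
Lemma PP_supported n m pi i j : PP n m pi -> n <= i -> pi i j = 0.
Proof.
move=> [[_ pi_row _] rows _] ni; apply/eqP/negPn/negP => piij.
have: (`I_n.+1 #<= `I_n)%card.
  apply: card_le_trans rows; apply: subset_card_le => a /= an.
  exists j; apply: contra piij => /eqP pia0.
  have: a <= i by lia.
  elim: {ni} i => [|i IHi] ai.
    by rewrite -pia0; apply/eqP; congr pi; lia.
  move: ai; rewrite leq_eqVlt => /predU1P[<-|/IHi]; first by rewrite pia0.
  by have := pi_row i j; lia.
by rewrite card_le_II ltnn.
Qed.

Lemma PP_levels n m pi : PP n m pi ->
  exists2 G, box_monotone n m G & levels pi G.
Proof.
move=> piP; have [[pi_fin pi_row pi_col] _ pi_m] := piP.
(* Finite support bounds the nonzero columns, so one [N] serves to conjugate every row. *)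
have [N piN] : exists N, forall i j, N <= j -> pi i j = 0.
  have /finite_seqP[X piX] := pi_fin.
  exists (\max_(p <- X) p.2).+1 => i j; apply: contraTeq => piij.
  rewrite -ltnNge ltnS; apply: (@leq_bigmax_seq _ _ xpredT snd (i, j)) => //.
  by have : [set` X] (i, j) by rewrite -piX.
exists (fun i b => conj_count N (pi i) b); last first.
  by move=> i j b; rewrite conj_countP // piN.
have piG i j b : (j < conj_count N (pi i) b) = (b < pi i j).
  by rewrite conj_countP // piN.
split=> [i b ib|i b|i b]; last 2 first.
- by rewrite leqNgt piG -leqNgt (leq_trans (pi_row _ _)) // leqNgt -piG ltnn.
- by rewrite leqNgt piG -leqNgt (@leq_trans b) // leqNgt -piG ltnn.
apply/eqP; rewrite -leqn0 leqNgt piG -leqNgt; case/orP: ib => [ni|mb].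
  by rewrite (PP_supported _ piP).
exact: leq_trans mb.
Qed.

Lemma levels_PP n m pi G : box_monotone n m G -> levels pi G -> PP n m pi.
Proof.
move=> Gmono piG; have [Gs Gi Gb] := Gmono.
have piE i j b : (pi i j <= b) = (G i b <= j) by rewrite leqNgt piG -leqNgt.
have pi_row i : n <= i -> forall j, pi i j = 0.
  by move=> ni j; apply/eqP; rewrite -leqn0 piE Gs ?ni.
split; first split.
- apply: (@sub_finite_set _ _ (`I_n `*` `I_(G 0 0))); last first.
    by apply: finite_setX; exact: finite_II.
  move=> [i j] /=; rewrite -lt0n piG => jG; split=> /=.
    by rewrite ltnNge; apply/negP => ni; rewrite Gs ?ni in jG.
  by apply: leq_trans jG _; exact: box_monotone_le00 Gmono.
- by move=> i j; rewrite piE (leq_trans (Gi _ _)) // -piE.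
- by move=> i j; rewrite piE (leq_trans _ (leqnSn j)) // -piE.
- apply: subset_card_le => i /= [j]; apply: contra_neqT; rewrite -leqNgt.
  by move=> /pi_row ->.
- by move=> i j; rewrite piE Gs // leqnn orbT.
Qed.

End LastPassage.

(** * The bijection between n x m arrays and plane partitions *)

Section CellArrays.
Local Open Scope nat_scope.
Variables n m : nat.
Implicit Types f g : 'I_n * 'I_m -> nat.

Definition extend f i b : nat :=
  if insub i is Some a then if insub b is Some c then f (a, c) else 0 else 0.

Lemma extend_supported f : supported n m (extend f).
Proof.
move=> i b; rewrite /extend; case: insubP => // a ia _.
by case: insubP => // c bc _; lia.
Qed.

Lemma extendE f (p : 'I_n * 'I_m) : extend f p.1 p.2 = f p.
Proof. by case: p => a c; rewrite /extend /= !valK. Qed.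

Definition pp_of f : nat -> nat -> nat :=
  fun i j => conj_count m (lp n m (extend f) i) j.

Lemma pp_of_levels f : levels (pp_of f) (lp n m (extend f)).
Proof.
exact: box_monotone_levels (lp_box_monotone (extend_supported f)).
Qed.

Lemma pp_of_PP f : PP n m (pp_of f).
Proof.
exact: levels_PP (lp_box_monotone (extend_supported f)) (pp_of_levels f).
Qed.

(** Conjugation recovers the last-passage array from the partition, and the recursion then gives [f]
    as a difference. *)
Lemma pp_of_inj f g : pp_of f = pp_of g -> f =1 g.
Proof.
move=> fg p; have L := pp_of_levels f; rewrite fg in L.
have E := levels_inj L (pp_of_levels g).
have := lpP (extend_supported f) p.1 p.2.
have := lpP (extend_supported g) p.1 p.2.
by rewrite !E !extendE; lia.
Qed.

Lemma pp_of_surj pi : PP n m pi -> exists f, pi = pp_of f.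
Proof.
move=> /PP_levels[G Gm piG]; have [Gs Gi Gb] := Gm.
(* The recursion solved for [D]; monotonicity of [G] makes the truncated subtraction exact. *)
pose f (p : 'I_n * 'I_m) := G p.1 p.2 - maxn (G p.1.+1 p.2) (G p.1 p.2.+1).
exists f; have GE : lp_eqn (extend f) G.
  move=> i b; have [ib|] := boolP ((n <= i) || (m <= b)).
    by rewrite extend_supported // !Gs //; lia.
  rewrite negb_or -!ltnNge => /andP[ilt blt].
  rewrite (extendE f (Ordinal ilt, Ordinal blt)) /f /=.
  by have := Gi i b; have := Gb i b; lia.
have E := lp_eqn_inj Gs (lp_supported (extend_supported f)) GE
  (lpP (extend_supported f)).
apply/funext => i; apply/funext => j.
have := piG i j (pp_of f i j); have := piG i j (pi i j).
by rewrite !E -!pp_of_levels; lia.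
Qed.

End CellArrays.

(** * The descent weight in terms of conjugated rows *)

Lemma prodr_const_itv (S : pzSemiRingType) (x : S) (a c N : nat) :
  \prod_(j < N) (if (a <= j < c)%N then x else 1) = x ^+ (minn c N - a).
Proof.
elim: N => [|N IHN]; first by rewrite big_ord0 minn0.
rewrite big_ord_recr /= IHN.
have -> (q : bool) : (if q then x else 1) = x ^+ q by case: q.
by rewrite -exprD; congr (_ ^+ _); lia.
Qed.

Section Weight.
Variables (R : comNzRingType) (n m : nat).

Lemma des_weight_levels pi G : box_monotone n m G -> levels pi G ->
  des_weight R n m pi = \prod_(i < n) \prod_(b < m)
    (xvar R n m i.+1 * zvar R n m b.+1)
      ^+ (G i b - maxn (G i.+1 b) (G i b.+1)).
Proof.
(* [G 0 0] is the largest entry of [G], so the nonzero entries of [pi] lie in the first [N]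
   columns. *)
move=> Gm piG; have [Gs Gi Gb] := Gm; pose N := G 0%N 0%N.
have pi_lt i j : (0 < pi i j)%N -> (i < n)%N /\ (j < N)%N.
  rewrite piG => jG; split.
    by rewrite ltnNge; apply/negP => ni; rewrite Gs ?ni in jG.
  by rewrite (leq_trans jG) ?(box_monotone_le00 _ _ Gm).
have pi_le i j : (pi i j <= m)%N by rewrite leqNgt piG Gs // leqnn orbT.
pose w i j := xvar R n m i.+1 * zvar R n m (pi i j).
pose F i j := if (pi i.+1 j < pi i j)%N then w i j else 1.
have -> : des_weight R n m pi = \big[*%R/1]_(p \in `I_n `*` `I_N) F p.1 p.2.
  have -> : des_weight R n m pi =
      \big[*%R/1]_(p \in (`I_n `*` `I_N) `&` Des pi) w p.1 p.2.
    apply: eq_fsbigl; apply/seteqP; split=> [[i j] /= pij|p []//].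
    by split=> //; apply: pi_lt; exact: leq_ltn_trans pij.
  rewrite fsbig_mkcondr; apply: eq_fsbigr => p _; rewrite /F.
  by congr (if _ then _ else _); apply/idP/idP; rewrite inE.
rewrite -pair_fsbig; [|exact: finite_II..].
rewrite -fsbig_ord; apply: eq_bigr => i _; rewrite -fsbig_ord.
pose x b := xvar R n m i.+1 * zvar R n m b.+1.
(* The factor at [(i, j)] is spread over all levels [b], only [b + 1 = pi i j] contributing, so that
   the products over columns and levels can be exchanged. *)
transitivity (\prod_(j < N) \prod_(b < m)
    if (maxn (G i.+1 b) (G i b.+1) <= j < G i b)%N then x b else 1); last first.
  rewrite exchange_big; apply: eq_bigr => b _ /=.
  by rewrite prodr_const_itv (minn_idPl _) // (box_monotone_le00 _ _ Gm).
apply: eq_bigr => j _; rewrite -big_mkcond /=.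
have condE b : (maxn (G i.+1 b) (G i b.+1) <= j < G i b)%N =
    (pi i.+1 j < pi i j)%N && (pi i j == b.+1).
  by move: (piG i j b) (piG i j b.+1) (piG i.+1 j b); lia.
under [RHS]eq_bigl do rewrite condE.
rewrite /F /w; case: ifP => [pij|_]; last by rewrite big_pred0.
have pi_gt0 : (0 < pi i j)%N by apply: leq_ltn_trans pij.
have blt : ((pi i j).-1 < m)%N by rewrite prednK.
rewrite (big_pred1 (Ordinal blt)) /x /= ?prednK // => b.
by rewrite /= -val_eqE /=; lia.
Qed.

End Weight.

(** * Monomials and truncation of power series *)

Section Monomials.
Variables (k : nat) (R : comNzRingType).
Implicit Types (a b : 'X_{1..k}) (f g : {mfps R[k]}).

Definition mfpsXm a : {mfps R[k]} := MFps (fun c => (c == a)%:R).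

Lemma mfpsXmD a b : mfpsXm (a + b)%MM = mfpsXm a * mfpsXm b.
Proof.
have agree a' d : mfps_agree d 'X_[a'] (mfpsXm a').
  by move=> c _; rewrite mcoeffX eq_sym.
apply: mfpsP => c; apply: (mfps_agree_inj (leqnn _) (agree _ _)).
by rewrite mpolyXD; exact: mfps_agreeM.
Qed.

Lemma mfpsXm0 : mfpsXm 0%MM = 1.
Proof. by apply: mfpsP => c; rewrite mfps1. Qed.

Lemma mfpsXmX a e : mfpsXm a ^+ e = mfpsXm (a *+ e)%MM.
Proof.
by elim: e => [|e IHe]; rewrite ?mulm0n ?mfpsXm0 // exprS IHe mulmS mfpsXmD.
Qed.

Lemma mfpsXm_prod (I : finType) (F : I -> 'X_{1..k}) :
  \prod_i mfpsXm (F i) = mfpsXm (\sum_i F i)%MM.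
Proof. by rewrite (big_morph mfpsXm mfpsXmD mfpsXm0). Qed.

Lemma mfps_sumE (I : finType) (F : I -> {mfps R[k]}) c :
  (\sum_i F i) c = \sum_i F i c.
Proof. by apply: (big_morph (fun f : {mfps R[k]} => f c)) => [g h|]. Qed.

(** This allows each geometric series in a product to be replaced by a finite sum when only degrees
    up to [d] matter. *)
Lemma mfps_eq_prod d (I : finType) (F F' : I -> {mfps R[k]}) :
  (forall i c, (mdeg c <= d)%N -> F i c = F' i c) ->
  forall c, (mdeg c <= d)%N -> (\prod_i F i) c = (\prod_i F' i) c.
Proof.
move=> FF'; apply: (big_ind2 (fun f g : {mfps R[k]} =>
  forall c, (mdeg c <= d)%N -> f c = g c)) => // [f f' g g'|i _].
  exact: mfps_eqM.
exact: FF'.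
Qed.

End Monomials.

(** The finite sum times [1 - f] telescopes to [1 - f ^+ d.+1], and [f ^+ d.+1] has no term of
    degree at most [d]. *)
Lemma mfps_inv_geom k (R : comUnitRingType) (f : {mfps R[k]}) d c :
  f 0%MM = 0 -> (mdeg c <= d)%N ->
  (1 - f)^-1 c = (\sum_(e < d.+1) f ^+ e) c.
Proof.
move=> f0 cd; have fU : 1 - f \is a GRing.unit.
  by rewrite mfps_unitE mfpsD mfpsN f0 mfps1 eqxx subr0 unitr1.
have -> : \sum_(e < d.+1) f ^+ e = (1 - f)^-1 * (1 - f ^+ d.+1).
  apply: (mulrI fU); rewrite mulrA divrr // mul1r -[in RHS]opprB subrX1.
  by rewrite -mulNr opprB.
rewrite -[in LHS](mulr1 (1 - f)^-1); apply: (mfps_eqM (d := d)) => // b bd.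
by rewrite mfpsD mfpsN mfps_exp_low ?subr0.
Qed.

(** * Monomials attached to arrays *)

Section CellMonomials.
Variables n m : nat.
Implicit Types (f : 'I_n * 'I_m -> nat) (p : 'I_n * 'I_m).

Definition cell_mnm p : 'X_{1..n + m} :=
  (U_(lshift m p.1) + U_(rshift n p.2))%MM.

Definition array_mnm f : 'X_{1..n + m} := (\sum_p cell_mnm p *+ f p)%MM.

(** A cell monomial has degree 2, so each entry counts twice in the degree. The bound leaves
    finitely many arrays for a given monomial. *)
Lemma leq_array_mdeg f p : (f p <= mdeg (array_mnm f))%N.
Proof.
rewrite /array_mnm mdeg_sum (bigD1 p) //= (leq_trans _ (leq_addr _ _)) //.
by rewrite mdegMn /cell_mnm mdegD !mdeg1; lia.
Qed.

Variable R : comNzRingType.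

Lemma cell_weight p :
  xvar R n m p.1.+1 * zvar R n m p.2.+1 = mfpsXm R (cell_mnm p).
Proof.
rewrite /xvar (big_pred1 p.1) //; rewrite /zvar (big_pred1 p.2) //.
by rewrite mfpsXmD.
Qed.

Lemma des_weight_pp_of f :
  des_weight R n m (pp_of f) = mfpsXm R (array_mnm f).
Proof.
have fS := extend_supported f.
rewrite (des_weight_levels _ (lp_box_monotone fS) (@pp_of_levels _ _ f)).
rewrite pair_bigA -mfpsXm_prod; apply: eq_bigr => p _ /=.
(* By the recursion, the last-passage value minus the maximum is [f p]. *)
rewrite cell_weight mfpsXmX (lpP fS) extendE; congr (mfpsXm _ (_ *+ _)%MM); lia.
Qed.

End CellMonomials.

(** * Comparison of coefficients *)

Theorem theorem4p1 (R : comUnitRingType) (n m : nat)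
    (hn : (1 <= n)%N) (hm : (1 <= m)%N) :
  mfps_summable (PP n m) (des_weight R n m) /\
  mfps_sum (PP n m) (des_weight R n m) =
    \prod_(1 <= i < n.+1) \prod_(1 <= l < m.+1)
      (1 - xvar R n m i * zvar R n m l)^-1.
Proof.
(* Only arrays with entries at most [d] can contribute to a coefficient of degree [d], which makes
   every sum below finite. *)
pose h d (F : {ffun 'I_n * 'I_m -> 'I_d.+1}) := pp_of (fun p => F p : nat).
have h_range c pi : PP n m pi -> des_weight R n m pi c != 0 ->
    range (@h (mdeg c)) pi.
  move=> /pp_of_surj[f ->]; rewrite des_weight_pp_of /=.
  have [cE _|_] := eqVneq c; last by rewrite eqxx.
  exists [ffun p => inord (f p)] => //; rewrite /h; congr pp_of.
  by apply/funext => p; rewrite ffunE inordK // ltnS cE leq_array_mdeg.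
split=> [c|].
  apply: (sub_finite_set _ (finite_image (@h (mdeg c))
                                         (finite_finset (X := setT)))).
  by move=> pi [piP]; exact: h_range.
apply: mfpsP => c; pose d := mdeg c.
have -> : mfps_sum (PP n m) (des_weight R n m) c =
    \sum_(F : {ffun 'I_n * 'I_m -> 'I_d.+1})
      (c == array_mnm (fun p => F p : nat))%:R.
  rewrite /= -(fsbig_widen (range (@h d))); last 2 first.
  - by move=> _ [F _ <-]; exact: pp_of_PP.
  - move=> pi [piP nrange] /=; apply/eqP/negPn/negP => /(h_range _ _ piP).
    exact: nrange.
  rewrite fsbig_image; last first.
    move=> F F' _ _ /pp_of_inj FF'; apply/ffunP => p; apply/val_inj.
    exact: FF'.
  rewrite [RHS]fsbig_seq ?index_enum_uniq //.
  rewrite (_ : [set` _] = setT); last first.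
    by apply/seteqP; split=> // F _ /=; rewrite mem_index_enum.
  by apply: eq_fsbigr => F _; rewrite des_weight_pp_of.
rewrite !big_add1 /= big_mkord.
under [in RHS]eq_bigr do rewrite big_add1 /= big_mkord.
rewrite pair_bigA /=.
rewrite (mfps_eq_prod (d := d)
  (F' := fun p => \sum_(e < d.+1) mfpsXm R (cell_mnm p) ^+ e)) //; last first.
  (* The cell monomial has degree 2, hence the zero constant term that the geometric series
     requires. *)
  move=> p b bd; rewrite cell_weight (mfps_inv_geom _ bd) //= eq_sym -mdeg_eq0.
  by rewrite mdegD !mdeg1.
(* Expanding the product chooses an exponent at most [d] in every cell, so the sum runs over the
   same arrays [F]. *)
rewrite bigA_distr_bigA mfps_sumE; apply: eq_bigr => F _.
by under eq_bigr do rewrite mfpsXmX; rewrite mfpsXm_prod.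
Qed.
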